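(* For all $d\ge 1$ and all $r\in V(Q^d)$ we have $z_{Q^d,r}<2\pi(Q^d,r)$.
   Context: $Q^d$ is the $d$-dimensional hypercube graph (vertices: subsets of $\{1,\dots,d\}$, adjacent when they differ in exactly one element). A configuration on a connected graph $G$ is a function $C:V(G)\to\mathbb{N}$; a pebbling step from $u$ to a neighbor $v$ removes two pebbles from $u$ and adds one to $v$; $C$ is $r$-solvable if some sequence of pebbling steps places a pebble on $r$. $\pi(G,r)$ is the minimum $t$ such that every configuration with $t$ pebbles in total is $r$-solvable. A strategy rooted at $r$ is a subtree $T$ of $G$ containing $r$ with at least two vertices, rooted at $r$ ($v^+$ = parent of $v$), with a nonnegative, not identically zero weight function $w$ on $V(G)$ such that $w(r)=0$, $w(v)=0$ off $T$, and $w(v^+)=2w(v)$ for every $v\in V(T)\setminus\{r\}$ whose parent is not $r$. Write $w(C)=\sum_v w(v)C(v)$ and $w(\mathbf{T})=\sum_{v\in V(T)}w(v)$. $z_{G,r}$ is the optimal value of the integer optimization problem: maximize $\sum_{v\neq r}C(v)$ over configurations $C$ subject to $w(C)\le w(\mathbf{T})$ for every strategy $T$ rooted at $r$ with its weight function $w$. *)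

(* Defs.v *)
From HB Require Import structures.
From mathcomp Require Import all_boot all_order all_algebra.
From mathcomp Require Import boolp reals zify.

Set Implicit Arguments.
Unset Strict Implicit.
Unset Printing Implicit Defensive.

Import Order.TTheory GRing.Theory Num.Theory.

(* Finite, simple, connected graphs. *)
Record cgraph := CGraph {
  vertex :> finType;
  adj : rel vertex;
  adj_sym : symmetric adj;
  adj_irrefl : irreflexive adj;
  adj_connected : forall x y, connect adj x y }.

Section Hypercube.
Variable d : nat.
Implicit Types A B : {set 'I_d}.

Definition cube_adj : rel {set 'I_d} :=
  fun A B => #|(A :\: B) :|: (B :\: A)| == 1.

Lemma cube_adj_sym : symmetric cube_adj.
Proof. by move=> A B; rewrite /cube_adj setUC. Qed.

Lemma cube_adj_irrefl : irreflexive cube_adj.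
Proof. by move=> A; rewrite /cube_adj setDv setU0 cards0. Qed.

Lemma cube_adj_connected A B : connect cube_adj A B.
Proof.
have H0 : forall n (C : {set 'I_d}), #|C| = n -> connect cube_adj C set0.
  elim=> [|n IH] C hC; first by rewrite (cards0_eq hC).
  have [x xC] : exists x, x \in C by apply/card_gt0P; rewrite hC.
  apply: (connect_trans _ (IH (C :\ x) _)); last first.
    by have := cardsD1 x C; rewrite xC hC => -[].
  apply: connect1; rewrite /cube_adj.
  suff -> : C :\: (C :\ x) :|: (C :\ x) :\: C = [set x] by rewrite cards1.
  apply/setP=> y; rewrite !inE; case: eqVneq => [->|_] /=; first by rewrite xC.
  by case: (y \in C).
apply: (connect_trans (H0 _ A erefl)).
by rewrite (sym_connect_sym cube_adj_sym); apply: (H0 _ B erefl).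
Qed.

Definition hypercube : cgraph :=
  CGraph cube_adj_sym cube_adj_irrefl cube_adj_connected.

End Hypercube.

Definition config (G : cgraph) := {ffun G -> nat}.

Definition pebbling_step (G : cgraph) : rel (config G) := fun C C' =>
  [exists u : G, exists v : G,
    [&& adj u v, 2 <= C u
      & C' == [ffun x => if x == u then C x - 2
                         else if x == v then C x + 1 else C x]]].

(* The sequence of steps may be empty. *)
Definition solvable (G : cgraph) (r : G) (C : config G) : Prop :=
  exists s : seq (config G),
    path (@pebbling_step G) C s /\ 0 < last C s r.

Section PebblingNumber.
Variables (G : cgraph) (r : G).

Definition all_solvable (t : nat) : Prop :=
  forall C : config G, \sum_v C v = t -> solvable r C.

Lemma pebbling_move (u v : G) m (C : config G) :
    adj u v -> m.*2 <= C u ->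
  exists s, path (@pebbling_step G) C s /\ m <= last C s v.
Proof.
move=> uv; suff: m.*2 <= C u ->
    exists s, path (@pebbling_step G) C s /\ C v + m <= last C s v.
  by move=> H /H [s [? ?]]; exists s; split=> //; lia.
have vNu : v != u by apply: contraTneq uv => ->; rewrite adj_irrefl.
elim: m C => [|m IH] C hC; first by exists [::]; rewrite addn0.
pose C' : config G := [ffun x => if x == u then C x - 2
                         else if x == v then C x + 1 else C x].
have [|s [ps ls]] := IH C'; first by rewrite ffunE eqxx; lia.
exists (C' :: s); split=> /=.
  rewrite ps andbT; apply/existsP; exists u; apply/existsP; exists v.
  by rewrite uv eqxx andbT /=; lia.
by move: ls; rewrite [in X in X -> _]ffunE (negPf vNu) eqxx; lia.
Qed.

Lemma solvable_of_pile (q : seq G) (v : G) (C : config G) :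
  path (@adj G) v q -> last v q = r -> 2 ^ size q <= C v -> solvable r C.
Proof.
elim: q v C => [|u q IH] v C /=; first by move=> _ <- h; exists [::].
case/andP=> vu pq lq; rewrite expnS mul2n => /(pebbling_move vu) [s [ps hs]].
have [s' [ps' hs']] := IH u _ pq lq hs.
by exists (s ++ s'); rewrite cat_path last_cat ps ps'.
Qed.

Lemma all_solvable_exists : exists t, `[< all_solvable t >].
Proof.
exists (#|G| * 2 ^ #|G|); apply/asboolP => C hC.
have [v hv] : exists v, 2 ^ #|G| <= C v.
  apply/existsP; apply: contra_eqT hC; rewrite negb_exists => /forallP h.
  rewrite neq_ltn; apply/orP; left; rewrite -sum_nat_const.
  apply: (@leq_trans (\sum_(v : G) (C v).+1)).
    rewrite (bigD1 r) //= [X in _ < X](bigD1 r) //= addSn ltnS leq_add2l.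
    exact: leq_sum.
  by apply: leq_sum => v _; rewrite ltnNge.
have /connectP [p pp lp] := adj_connected v r.
case/shortenP: pp lp => q pq uq _ lq.
apply: (solvable_of_pile pq (esym lq)); apply: leq_trans hv.
rewrite leq_exp2l //; have := max_card (mem (v :: q)).
by rewrite (card_uniqP uq) /= => /ltnW.
Qed.

(* pi(G,r). *)
Definition pebbling_number : nat := ex_minn all_solvable_exists.

End PebblingNumber.

Section Subtree.
Variables (G : cgraph) (S : {set G}) (E : rel G).

Definition is_subgraph : Prop :=
  symmetric E /\ forall x y, E x y -> [/\ x \in S, y \in S & adj x y].

(* A cycle of size 2 is an edge traversed back and forth, hence the bound. *)
Definition is_subtree : Prop :=
  [/\ is_subgraph,
      forall x y, x \in S -> y \in S -> connect E x y
    & forall c : seq G, 2 < size c -> ~ ucycle E c].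

(* u is the vertex just before v on the simple path from r to v. *)
Definition is_parent (r u v : G) : Prop :=
  exists p : seq G,
    [/\ path E r (rcons p v), uniq (r :: rcons p v) & last r p = u].

End Subtree.

Section Strategy.
Local Open Scope ring_scope.
Variables (R : realType) (G : cgraph) (r : G).

(* (S, E) is the tree T. The condition [u != r] exempts the children of the
   root, whose weights are independent of each other. *)
Definition is_strategy (S : {set G}) (E : rel G) (w : G -> R) : Prop :=
  [/\ [/\ is_subtree S E, r \in S & (1 < #|S|)%N],
      (forall v, 0 <= w v) /\ (exists v, w v != 0),
      w r = 0,
      (forall v, v \notin S -> w v = 0)
    & forall u v, is_parent E r u v -> u != r -> w u = 2 * w v].

Definition feasible (C : config G) : Prop :=
  forall (S : {set G}) (E : rel G) (w : G -> R), is_strategy S E w ->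
    \sum_v w v * (C v)%:R <= \sum_(v in S) w v.

Definition attained (n : nat) : Prop :=
  exists C : config G, feasible C /\ (\sum_(v | v != r) C v)%N = n.

Lemma attained_exists : exists n, `[< attained n >].
Proof.
exists 0%N; apply/asboolP; exists [ffun=> 0%N]; split; last first.
  by rewrite big1 // => v _; rewrite ffunE.
move=> S E w [_ [w0 _] _ _ _]; rewrite big1 ?sumr_ge0 //.
by move=> v _; rewrite ffunE mulr0.
Qed.

(* A path from r to v carries a strategy, which bounds C v. *)
Section PathStrategy.
Variable q : seq G.
Hypotheses (pq : path (@adj G) r q) (uq : uniq (r :: q)) (q0 : (0 < size q)%N).
Let p := r :: q.

Let E : rel G := fun x y => [&& x \in p, y \in p &
  (index y p == (index x p).+1) || (index x p == (index y p).+1)].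
Let S := [set x in p].
Let w (x : G) : R :=
  if (x \in p) && (x != r) then 2 ^+ (size q - index x p) else 0.

Let index_r : index r p = 0%N. Proof. by rewrite /p /= eqxx. Qed.

Let index_inj x y : x \in p -> y \in p -> index x p = index y p -> x = y.
Proof. by move=> xp yp h; rewrite -(nth_index r xp) h nth_index. Qed.

Let E_adj x y : E x y -> adj x y.
Proof.
have H a b : a \in p -> b \in p -> index b p = (index a p).+1 -> adj a b.
  move=> ap bp h; have hb : (index a p < size q)%N.
    by move: bp; rewrite -index_mem h /=.
  have := pathP r pq _ hb.
  by rewrite -[nth r q _]/(nth r p _.+1) -h !nth_index.
by case/and3P=> xp yp /orP [] /eqP h; [|rewrite adj_sym]; apply: H.
Qed.

Let E_sym : symmetric E.
Proof. by move=> x y; rewrite /E orbC andbCA. Qed.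

Let connect_root x : x \in p -> connect E r x.
Proof.
move=> xp; have [n hn] : exists n, index x p = n by exists (index x p).
elim: n x xp hn => [|n IH] x xp hn.
  by rewrite (@index_inj r x) ?connect0 ?mem_head // index_r hn.
have hs : (n < size p)%N by apply: ltnW; rewrite -hn index_mem.
have yp := mem_nth r hs; have iy := index_uniq r hs uq.
apply: (connect_trans (IH _ yp iy)); apply: connect1.
by rewrite /E yp xp iy hn eqxx.
Qed.

Let acyclicE c : (2 < size c)%N -> ~ ucycle E c.
Proof.
move=> c2 /andP [cc uc].
have [x0 x0c] : exists x, x \in c.
  by case: c c2 {cc uc} => // x c _; exists x; rewrite mem_head.
have [x xc xmax] := @arg_maxnP _ x0 (fun x => x \in c)
  (fun x => index x p) x0c.
have [i s es] := rot_to xc.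
move: cc uc c2; rewrite -(rot_cycle i) -(rot_uniq i) -(size_rot i) es.
have sub y : y \in x :: s -> (index y p <= index x p)%N.
  by rewrite -es mem_rot; apply: xmax.
case: s es sub => [|y s] // _; case: (lastP s) => [|s' z] //.
move=> sub /=; rewrite rcons_path last_rcons => /and3P [xy _ zx].
move=> /and3P [_ yz _] _.
have iy : (index y p <= index x p)%N by apply: sub; rewrite !inE eqxx orbT.
have iz : (index z p <= index x p)%N.
  by apply: sub; rewrite !in_cons mem_rcons mem_head !orbT.
case/and3P: xy => xp yp hy; case/and3P: zx => zp _ hz.
have e : y = z by apply: index_inj => //; lia.
by move: yz; rewrite e mem_rcons mem_head.
Qed.

Let path_reaches s k : path E r s -> (k <= index (last r s) p)%N ->
  exists2 x, x \in r :: s & (x \in p) && (index x p == k).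
Proof.
elim/last_ind: s => [|s x IH].
  rewrite [last _ _]/= index_r leqn0 => _ /eqP ->.
  by exists r; rewrite ?index_r mem_head.
rewrite rcons_path last_rcons => /andP [ps /and3P [lp xp hx]] kx.
have [kl|kl] := leqP k (index (last r s) p).
  have [y ys hy] := IH ps kl; exists y => //.
  by rewrite -rcons_cons mem_rcons inE ys orbT.
by exists x; [rewrite -rcons_cons mem_rcons mem_head|rewrite xp; lia].
Qed.

Lemma path_strategy : is_strategy S E w.
Proof.
split.
- split; first split.
  + split=> // x y exy; rewrite !inE.
    by case/and3P: (exy) => xp yp _; split=> //; apply: E_adj.
  + move=> x y; rewrite !inE => xp yp; apply: (connect_trans _ (connect_root yp)).
    by rewrite (sym_connect_sym E_sym) connect_root.
  + exact: acyclicE.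
  + by rewrite inE mem_head.
  + by rewrite cardsE (card_uniqP uq).
- split=> [v|]; first by rewrite /w; case: ifP => // _; apply: exprn_ge0.
  exists (head r q); move: q0 uq; rewrite /w /p; case: (q) => // a q' _ /=.
  rewrite !inE eqxx orbT negb_or => /andP [/andP [ra _] _].
  rewrite eq_sym in ra.
  by rewrite ra expf_neq0 // pnatr_eq0.
- by rewrite /w eqxx andbF.
- by move=> v; rewrite inE /w => /negPf ->.
move=> u v [s []]; rewrite rcons_path => /andP [ps ls] us lu.
rewrite lu in ls; move=> ur; case/and3P: ls => up vp huv.
have vNs : v \notin r :: s.
  by move: us; rewrite -rcons_cons rcons_uniq => /andP [].
have vr : v != r by apply: contraNneq vNs => ->; rewrite mem_head.
have hv : index v p = (index u p).+1.
  case/orP: huv => /eqP // h; case/negP: vNs.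
  have [|x xs /andP [xp /eqP ix]] := @path_reaches s (index v p) ps.
    by rewrite lu h.
  by rewrite -(index_inj xp vp ix).
rewrite /w up vp ur vr [true && true]/= -exprS; congr (_ ^+ _).
have hs : (index v p <= size q)%N.
  by rewrite -ltnS -[(size q).+1]/(size p) index_mem.
by rewrite hv in hs *; rewrite subnSK.
Qed.

Lemma path_bound C : feasible C -> ((C (last r q))%:R : R) <= \sum_(x in S) w x.
Proof.
move=> /(_ _ _ _ path_strategy); apply: le_trans.
have w0 x : 0 <= w x by rewrite /w; case: ifP => // _; apply: exprn_ge0.
rewrite (bigD1 (last r q)) //= -[X in X <= _]addr0; apply: lerD.
  rewrite -[X in X <= _]mul1r ler_wpM2r ?ler0n // /w.
  have -> : last r q \in p by rewrite /p mem_last.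
  have -> : last r q != r.
    move: q0 uq; case: (q) => //= a q' _ /andP [raq _].
    by apply: contraNneq raq => {1}<-; rewrite mem_last.
  by rewrite /= exprn_ege1 // ler1n.
by apply: sumr_ge0 => x _; rewrite mulr_ge0.
Qed.
End PathStrategy.

Lemma feasible_bound (v : G) : v != r ->
  exists B : nat, forall C, feasible C -> (C v <= B)%N.
Proof.
move=> vr; have /connectP [p pp lp] := adj_connected r v.
case/shortenP: pp lp => q pq uq _ lq.
have q0 : (0 < size q)%N by case: (q) lq vr => //= ->; rewrite eqxx.
have := path_bound pq uq q0; rewrite -lq.
set W := \sum_(x in _) _ => hW; exists (Num.bound `|W|) => C /hW h.
rewrite -(ler_nat R); apply: (le_trans h).
by apply: (le_trans (ler_norm _)); apply/ltW/archi_boundP; exact: normr_ge0.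
Qed.

Lemma attained_bounded : exists m, forall n, `[< attained n >] -> (n <= m)%N.
Proof.
have /choice [B hB] : forall v : G, exists B : nat,
    v != r -> forall C, feasible C -> (C v <= B)%N.
  move=> v; have [->|/feasible_bound [B hB]] := eqVneq v r.
    by exists 0%N.
  by exists B.
exists (\sum_v B v)%N => n /asboolP [C [fC <-]].
rewrite big_mkcond leq_sum // => v _; case: ifP => // vr; exact: hB.
Qed.

(* z_{G,r}. *)
Definition weight_optimum : nat :=
  ex_maxn attained_exists (projT2 (cid attained_bounded)).

End Strategy.

(* Main.v *)
(** Identify a vertex of the cube with the set of coordinates in which it
    differs from the root. For every set [A] of coordinates there is a
    strategy made of a chain of initial segments of [A], from the empty set up
    to [A], followed by a spanning tree of all supersets of [A], where a set
    [B] has weight [2 ^ (d - #|B|)]. Summing over all [A], a nonempty [B] gets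
    at least [2 ^ #|B| * 2 ^ (d - #|B|) = 2 ^ d] from the sets [A] it contains;
    the total weight exceeds [2 ^ d * (2 ^ d - 1)] only by the chains, and each
    chain weighs less than [2 ^ d]. Hence a feasible configuration has fewer
    than [2 ^ d.+1] pebbles, whereas [2 ^ d - 1] pebbles on the antipode of the
    root are not enough to reach it. *)
Require Import Defs.
From mathcomp Require Import all_boot all_order all_algebra.
From mathcomp Require Import boolp reals.
From mathcomp Require Import zify.

Import GRing.Theory Num.Theory.

(** * Strategies given by a parent function *)

Section ParentTree.
Variables (R : realType) (G : cgraph) (r : G) (S : {set G}).
Variables (par : G -> G) (depth : G -> nat).
Hypothesis rS : r \in S.
Hypothesis parP : forall v, v \in S -> v != r ->
  [/\ par v \in S, adj v (par v) & depth (par v) < depth v].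

Definition parent_edge : rel G := fun x y => [&& x \in S, y \in S &
  ((x != r) && (par x == y)) || ((y != r) && (par y == x))].

Lemma parent_edge_sym : symmetric parent_edge.
Proof. by move=> x y; rewrite /parent_edge orbC andbCA. Qed.

Lemma parent_edge_adj x y : parent_edge x y -> adj x y.
Proof.
case/and3P=> xS yS /orP [] /andP [nr /eqP <-].
  by case: (parP _ xS nr).
by rewrite adj_sym; case: (parP _ yS nr).
Qed.

Lemma parent_edge_connect_root x : x \in S -> connect parent_edge x r.
Proof.
have [n] := ubnP (depth x); elim: n x => // n IH x dx xS.
have [->|xr] := eqVneq x r; first exact: connect0.
have [pS _ dp] := parP _ xS xr.
apply: (connect_trans _ (IH _ (leq_trans dp dx) pS)).
by apply: connect1; rewrite /parent_edge xS pS xr eqxx.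
Qed.

(* Both neighbours on a cycle of a vertex of maximal depth are its parent. *)
Lemma parent_edge_acyclic (c : seq G) : 2 < size c -> ~ ucycle parent_edge c.
Proof.
move=> c2 /andP [cc uc].
have [x0 x0c] : exists x, x \in c.
  by case: c c2 {cc uc} => // x c _; exists x; rewrite mem_head.
have [x xc xmax] := @arg_maxnP _ x0 (fun x => x \in c) depth x0c.
have [i s es] := rot_to xc.
have up y : y \in x :: s -> parent_edge x y -> par x = y.
  rewrite -es mem_rot => yc.
  case/and3P=> _ yS /orP [/andP [_ /eqP //]|/andP [yr /eqP pyx]].
  have [_ _] := parP _ yS yr; rewrite pyx => lt_xy.
  by have := leq_trans lt_xy (xmax y yc); rewrite ltnn.
move: cc uc c2; rewrite -(rot_cycle i) -(rot_uniq i) -(size_rot i) es.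
case: s {es} up => [|y s] //; case: (lastP s) => [|s' z] // up.
rewrite /= rcons_path last_rcons (parent_edge_sym z).
move=> /and3P [xy _ xz] /and3P [_ yz _] _.
have ey : par x = y by apply: up xy; rewrite !inE eqxx orbT.
have ez : par x = z.
  by apply: up xz; rewrite !in_cons mem_rcons mem_head !orbT.
by move: yz; rewrite -ey ez mem_rcons mem_head.
Qed.

(** On a simple path from [r] the first edge leads to a child, since [parent_edge] ignores [par r];
    a later edge up to a parent would revisit the preceding vertex. *)
Lemma parent_edge_last {p v} : path parent_edge r (rcons p v) ->
  uniq (r :: rcons p v) -> v \in S /\ par v = last r p.
Proof.
elim/last_ind: p v => [|p u IH] v.
  rewrite /= !andbT inE eq_sym => /and3P [_ vS h] vr.
  by split=> //; move: h; rewrite eqxx vr => /eqP.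
rewrite last_rcons rcons_path last_rcons => /andP [pu uv].
rewrite -rcons_cons rcons_uniq => /andP [vN us].
have [_ e] := IH _ pu us; case/and3P: uv => _ vS h; split=> //.
case/orP: h => /andP [_ /eqP //]; rewrite e => e'.
case/negP: vN; rewrite -e' -rcons_cons mem_rcons inE.
by rewrite mem_last orbT.
Qed.

(** Simple paths from [r] follow [par], so doubling has to be checked along [par] only. Weights in
    [nat] keep the later counting there. *)
Lemma parent_tree_bound (w : G -> nat) (C : config G) :
    1 < #|S| -> (exists v, 0 < w v) -> w r = 0 ->
    (forall v, v \notin S -> w v = 0) ->
    (forall v, v \in S -> v != r -> par v != r -> w (par v) = 2 * w v) ->
    feasible R r C ->
  \sum_v w v * C v <= \sum_(v in S) w v.
Proof.
move=> S1 [v0 w0] wr wS wpar fC.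
have /fC : is_strategy r S parent_edge (fun v => (w v)%:R%R : R).
  split; first 1 last.
  - split=> [v|]; first exact: ler0n.
    by exists v0; rewrite pnatr_eq0 -lt0n.
  - by rewrite wr.
  - by move=> v /wS ->.
  - move=> u v [p [pv uv lu]] ur; rewrite -natrM.
    have [vS pe] := parent_edge_last pv uv; rewrite -lu -pe wpar //; last first.
      by rewrite pe lu.
    by apply: contraTneq uv => ->; rewrite /= mem_rcons mem_head.
  - split=> //; split; [|move=> x y xS yS|exact: parent_edge_acyclic].
      split=> [|x y xy]; first exact: parent_edge_sym.
      by case/and3P: (xy) => xS yS _; split=> //; apply: parent_edge_adj.
    apply: (connect_trans (parent_edge_connect_root _ xS)).
    rewrite (sym_connect_sym parent_edge_sym).
    exact: parent_edge_connect_root.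
move=> /=; under eq_bigr do rewrite -natrM.
by rewrite -!natr_sum ler_nat.
Qed.

End ParentTree.

(** * Symmetric difference, the translation and the metric of the cube *)

Section SymmetricDifference.
Variable T : finType.
Implicit Types A B C : {set T}.

Definition symdiff A B := A :\: B :|: B :\: A.

Lemma symdiffK C : involutive (symdiff^~ C).
Proof. by move=> A; apply/setP=> x; rewrite !inE; do 2!case: (x \in _). Qed.

Lemma symdiffxx A : symdiff A A = set0.
Proof. by rewrite /symdiff setDv setU0. Qed.

Lemma symdiff0 A : symdiff set0 A = A.
Proof. by rewrite /symdiff set0D setD0 set0U. Qed.

Lemma symdiff_setC A : symdiff (~: A) A = setT.
Proof. by apply/setP=> x; rewrite !inE; case: (x \in A). Qed.

Lemma symdiff_cancelr A B C :
  symdiff (symdiff A C) (symdiff B C) = symdiff A B.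
Proof. by apply/setP=> x; rewrite !inE; do 3!case: (x \in _). Qed.

Lemma card_symdiff_triangle A B C :
  #|symdiff A C| <= #|symdiff A B| + #|symdiff B C|.
Proof.
apply: leq_trans (leq_subr #|symdiff A B :&: symdiff B C| _).
rewrite -cardsU subset_leq_card //; apply/subsetP=> x.
by rewrite !inE; do 3!case: (x \in _).
Qed.

Lemma symdiffD1 A x : x \in A -> symdiff A (A :\ x) = [set x].
Proof.
move=> xA; apply/setP=> y; rewrite !inE.
by case: eqVneq => [->|_]; [rewrite xA|case: (y \in A)].
Qed.

End SymmetricDifference.

Arguments symdiff {T} A B.

(** * Lower bound on the pebbling number *)

Section PebblingLowerBound.
Variables (d : nat) (r : hypercube d).

(** The exponent subtracts the distance from [v] to [r]: a pebble loses half its value with each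
    unit of distance, scaled by [2 ^ d] to stay in [nat]. *)
Let potential (C : config (hypercube d)) :=
  \sum_v C v * 2 ^ (d - #|symdiff v r|).

(** The new pebble is at most one unit closer to [r], so it is worth no more than the two pebbles it
    replaces. *)
Lemma potential_step {C C' : config (hypercube d)} :
  pebbling_step C C' -> potential C' <= potential C.
Proof.
case/existsP=> u /existsP [v /and3P [uv Cu /eqP ->]].
have vu : v != u by apply: contraTneq uv => ->; rewrite adj_irrefl.
pose pot (x : hypercube d) := 2 ^ (d - #|symdiff x r|).
have pick1 (y : hypercube d) n : \sum_x (x == y) * n * pot x = n * pot y.
  rewrite (bigD1 y) //= eqxx mul1n big1 ?addn0 // => x /negPf ->.
  by rewrite !mul0n.
(* Additions on both sides avoid truncated subtraction; [pick1] turns the extra terms into sums, so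
   the identity is checked vertex by vertex. *)
suff : potential [ffun x => if x == u then C x - 2
           else if x == v then C x + 1 else C x] + 2 * pot u
       = potential C + 1 * pot v.
  suff : pot v <= 2 * pot u by lia.
  have uv1 : #|symdiff u v| = 1 by exact/eqP.
  have := card_symdiff_triangle _ u v r; rewrite uv1 => tri.
  rewrite /pot -expnS leq_exp2l //; lia.
rewrite -[in LHS]pick1 -[in RHS]pick1 /potential -!big_split /=.
apply: eq_bigr => x _; rewrite ffunE -!mulnDl; congr (_ * _).
have [->|xu] := eqVneq x u.
  by rewrite eq_sym (negPf vu) mul1n mul0n addn0 subnK.
by case: (x == v); rewrite ?mul0n ?muln1 ?addn0.
Qed.

(** A pebble on the antipode has potential 1, whereas one pebble on [r] is already worth [2 ^ d]. *)
Lemma pebbling_number_ge : 2 ^ d <= pebbling_number r.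
Proof.
rewrite /pebbling_number; case: ex_minnP => t /asboolP ht _.
pose antipode : hypercube d := ~: r.
pose C : config (hypercube d) := [ffun v => if v == antipode then t else 0].
have C_off v : v != antipode -> C v = 0 by move=> /negPf h; rewrite ffunE h.
have sumC : \sum_v C v = t.
  by rewrite (bigD1 antipode) //= big1 ?ffunE ?eqxx ?addn0.
have potC : potential C = t.
  rewrite /potential (bigD1 antipode) //= big1 ?addn0 => [|v /C_off ->] //.
  by rewrite ffunE eqxx symdiff_setC cardsT card_ord subnn muln1.
have [s [ps hs]] := ht C sumC.
have pot_last : potential (last C s) <= potential C.
  elim: s C ps {hs C_off sumC potC} => //= C' s IH C /andP [st /IH h].
  exact: leq_trans h (potential_step st).
rewrite -potC; apply: leq_trans pot_last.
rewrite /potential (bigD1 r) //= symdiffxx cards0 subn0.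
by apply: leq_trans (leq_addr _ _); rewrite leq_pmull.
Qed.

End PebblingLowerBound.

(** * The tree of each coordinate set and the total weights *)

Section Strategies.
Variable d : nat.
Implicit Types A B : {set 'I_d}.

Definition initial A k : {set 'I_d} := [set x in take k (enum A)].

Lemma card_initial A k : k <= #|A| -> #|initial A k| = k.
Proof.
move=> kA; rewrite cardsE (card_uniqP _) ?take_uniq ?enum_uniq //.
by rewrite size_takel // -cardE.
Qed.

Lemma initial_full A : initial A #|A| = A.
Proof. by rewrite /initial cardE take_size set_enum. Qed.

Lemma initialS A k : k < #|A| ->
  exists2 x, x \in initial A k.+1 & initial A k = initial A k.+1 :\ x.
Proof.
move=> kA; have [x0 _] : exists x, x \in A by apply/card_gt0P; case: #|A| kA.
have kA' : k < size (enum A) by rewrite -cardE.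
have u : uniq (rcons (take k (enum A)) (nth x0 (enum A) k)).
  by rewrite -take_nth // take_uniq // enum_uniq.
exists (nth x0 (enum A) k).
  by rewrite inE (take_nth x0 kA') mem_rcons mem_head.
apply/setP=> y; rewrite !inE (take_nth x0 kA') mem_rcons inE.
by case: eqVneq => //= ->; move: u; rewrite rcons_uniq => /andP [/negPf].
Qed.

(** The index stops short of [#|A|]: [A] itself is counted among its supersets. *)
Definition chain A := [set initial A k | k : 'I_#|A|].

Lemma initial_chain A k : k < #|A| -> initial A k \in chain A.
Proof. by move=> kA; apply/imsetP; exists (Ordinal kA). Qed.

Definition branch A := [set B : {set 'I_d} | (A \subset B) || (B \in chain A)].

Lemma branch_initial A B :
  B \in branch A -> B \subset A -> #|B| <= #|A| /\ B = initial A #|B|.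
Proof.
rewrite inE => /orP [AB BA|/imsetP [k _ ->] _].
  have -> : B = A by apply/eqP; rewrite eqEsubset BA.
  by rewrite initial_full.
by rewrite card_initial ltnW.
Qed.

Lemma set0_branch A : set0 \in branch A.
Proof.
have [->|] := set_0Vmem A; first by rewrite inE sub0set.
case=> x xA; have A0 : 0 < #|A| by apply/card_gt0P; exists x.
rewrite inE; apply/orP; right.
suff -> : set0 = initial A 0 by exact: initial_chain.
by apply/eqP; rewrite eq_sym -cards_eq0 card_initial.
Qed.

(** Dropping an element outside [A] keeps a superset of [A] above [A]; when none is left, one moves
    down the chain. At [B = A] the second case joins the two pieces. *)
Definition parent A B :=
  if [pick x in B :\: A] is Some x then B :\ x else initial A #|B|.-1.

Lemma parentP A B : B \in branch A -> B != set0 ->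
  parent A B \in branch A /\ exists2 x, x \in B & parent A B = B :\ x.
Proof.
move=> BS B0; rewrite /parent; case: pickP => [x|BA].
  rewrite !inE => /andP [xA xB]; split; last by exists x.
  move: BS; rewrite inE => /orP [AB|/imsetP [k _ e]].
    by rewrite subsetD1 AB xA.
  by case/negP: xA; move: xB; rewrite e inE => /mem_take; rewrite mem_enum.
have BsA : B \subset A.
  by rewrite -setD_eq0; apply/eqP/setP=> x; rewrite [RHS]inE; exact: BA.
have [BleA eB] := branch_initial _ _ BS BsA.
have : 0 < #|B| by rewrite card_gt0.
case: #|B| BleA eB => // k kA -> _ /=; split; last exact: initialS.
by rewrite inE initial_chain // orbT.
Qed.

Definition weight A B :=
  if (B \in branch A) && (B != set0) then 2 ^ (d - #|B|) else 0.

Lemma weight_parent A B : B \in branch A -> B != set0 ->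
  parent A B != set0 -> weight A (parent A B) = 2 * weight A B.
Proof.
move=> BS B0 p0; have [pS [x xB e]] := parentP _ _ BS B0.
rewrite /weight pS p0 BS B0 -expnS e; congr (_ ^ _).
have := max_card (mem B); rewrite card_ord (cardsD1 x B) xB => le_d.
by rewrite subnSK.
Qed.

Lemma sum_weight_ge B : B != set0 -> 2 ^ d <= \sum_A weight A B.
Proof.
move=> B0; have Bd : #|B| <= d by rewrite -[leqRHS]card_ord max_card.
rewrite -{1}(subnKC Bd) expnD -card_powerset -sum_nat_const.
rewrite big_mkcond leq_sum // => A _; rewrite powersetE /weight B0 inE andbT.
by case: (A \subset B).
Qed.

Lemma geometric_sum_lt n : n <= d -> \sum_(k < n | 0 < k) 2 ^ (d - k) < 2 ^ d.
Proof.
(* Repeating the last term makes the induction work: the two equal copies merge into the preceding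
   power of 2. *)
suff H : n <= d -> \sum_(k < n | 0 < k) 2 ^ (d - k) + 2 ^ (d - n.-1) <= 2 ^ d.
  by move=> /H; apply: leq_trans; rewrite -addn1 leq_add2l expn_gt0.
elim: n => [|n IH] nd; first by rewrite big_ord0 subn0.
rewrite big_mkcond big_ord_recr -big_mkcond /=.
case: n IH nd => [|n] IH nd; first by rewrite big_ord0 subn0.
rewrite -addnA addnn -mul2n -expnS subnSK //; last exact: ltnW.
exact/IH/ltnW.
Qed.

(** Members of a chain have distinct sizes below [#|A|], so the sum is geometric. *)
Lemma sum_chain_lt A : \sum_(B in chain A | B != set0) 2 ^ (d - #|B|) < 2 ^ d.
Proof.
have Ad : #|A| <= d by rewrite -[leqRHS]card_ord max_card.
have card_init (k : 'I_#|A|) : #|initial A k| = k.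
  by rewrite card_initial // ltnW.
rewrite big_mkcondr big_imset /=; last first.
  move=> i j _ _ /(congr1 (fun B : {set 'I_d} => #|B|)).
  by rewrite !card_init => /ord_inj.
rewrite -big_mkcondr; apply: leq_ltn_trans (geometric_sum_lt _ Ad).
under eq_bigl do rewrite -card_gt0 card_init.
by under eq_bigr do rewrite card_init.
Qed.

Lemma card_subsets : #|{set 'I_d}| = 2 ^ d.
Proof. by rewrite -cardsT -powersetT card_powerset cardsT card_ord. Qed.

Lemma sum_weight_lt : \sum_A \sum_B weight A B < 2 ^ d * 2 ^ d.+1.
Proof.
have cubes :
    \sum_(A : {set 'I_d})
      \sum_(B : {set 'I_d} | (A \subset B) && (B != set0)) 2 ^ (d - #|B|)
    <= 2 ^ d * 2 ^ d.
  (* After the exchange each nonempty [B] contributes exactly [2 ^ d]. *)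
  rewrite (exchange_big_dep (fun B => B != set0)) /= => [|A B _ /andP [] //].
  under eq_bigr => B B0.
    rewrite (eq_bigl (mem (powerset B))); last first.
      by move=> A; rewrite B0 andbT [RHS]powersetE.
    rewrite sum_nat_const card_powerset -expnD subnKC; last first.
      by rewrite -[leqRHS]card_ord max_card.
  over.
  by rewrite sum_nat_const leq_mul // -card_subsets max_card.
have chains :
    \sum_(A : {set 'I_d}) \sum_(B in chain A | B != set0) 2 ^ (d - #|B|)
    < 2 ^ d * 2 ^ d.
  have -> : 2 ^ d * 2 ^ d = \sum_(A : {set 'I_d}) 2 ^ d.
    by rewrite sum_nat_const card_subsets.
  (* One summand is split off to carry the strict inequality. *)
  rewrite (bigD1 set0) //= [ltnRHS](bigD1 set0) //= -addSn.
  by rewrite leq_add ?leq_sum // => [|A _]; [|apply: ltnW]; exact: sum_chain_lt.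
have -> : 2 ^ d * 2 ^ d.+1 = 2 ^ d * 2 ^ d + 2 ^ d * 2 ^ d.
  by rewrite expnS mulnCA mul2n addnn.
apply: leq_trans (leq_add cubes chains); rewrite addnS ltnS.
rewrite -big_split leq_sum //= => A _.
rewrite [X in _ <= X + _]big_mkcond [X in _ <= _ + X]big_mkcond -big_split.
rewrite leq_sum //= => B _; rewrite /weight inE.
case: (A \subset B); case: (B \in chain A); case: (B != set0) => //=;
  by rewrite ?addn0 ?leq_addr.
Qed.

End Strategies.

Arguments branch {d} A.
Arguments parent {d} A B.
Arguments weight {d} A B.

(** * Translation to an arbitrary root and summation over all strategies *)

Section CubeOptimum.
Variables (R : realType) (d : nat) (r : hypercube d).
Variable C : config (hypercube d).
Hypotheses (d_gt0 : 0 < d) (fC : feasible R r C).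

Let sum_symdiff (F : {set 'I_d} -> nat) :
  \sum_(v : hypercube d) F (symdiff v r) = \sum_B F B.
Proof. by rewrite [RHS](reindex_inj (inv_inj (symdiffK _ r))). Qed.

Let neq_r (v : hypercube d) : v != r -> symdiff v r != set0.
Proof.
by apply: contraNneq => v0; rewrite -(symdiffK _ r v) v0 symdiff0.
Qed.

Lemma strategy_bound (A : {set 'I_d}) :
  \sum_v weight A (symdiff v r) * C v <= \sum_B weight A B.
Proof.
pose S : {set hypercube d} := [set v | symdiff v r \in branch A].
pose par (v : hypercube d) : hypercube d :=
  symdiff (parent A (symdiff v r)) r.
have rS : r \in S by rewrite inE symdiffxx set0_branch.
(* The antipode of [r] lies in every tree; as [d] is positive it differs from [r], so it is both the
   second vertex and the one of nonzero weight. *)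
have top_weight : 0 < weight A (symdiff (~: r) r).
  rewrite symdiff_setC /weight inE subsetT /= -card_gt0 cardsT card_ord d_gt0.
  by rewrite expn_gt0.
have topS : (~: r : hypercube d) \in S.
  by rewrite inE; move: top_weight; rewrite /weight; case: (_ \in _).
have top_r : (~: r : hypercube d) != r.
  by apply: contraTneq top_weight => ->; rewrite symdiffxx /weight eqxx andbF.
have wS v : v \notin S -> weight A (symdiff v r) = 0.
  by rewrite inE /weight => /negPf ->.
have parD v : symdiff (par v) r = parent A (symdiff v r) by rewrite symdiffK.
apply: (@leq_trans (\sum_(v in S) weight A (symdiff v r))); last first.
  rewrite -sum_symdiff big_mkcond leq_sum // => v _.
  by case: (v \in S).
apply: (parent_tree_bound _ _ _ _ par (fun v => #|symdiff v r|)) fC => //.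
- move=> v; rewrite [v \in S]inE [par v \in S]inE parD => vS /neq_r v0.
  have [pS [x xB e]] := parentP _ _ _ vS v0.
  split=> //.
    apply/eqP; rewrite -(cards1 x) -(symdiffD1 _ _ _ xB) -e -parD.
    by rewrite symdiff_cancelr.
  by rewrite e (cardsD1 x (symdiff v r)) xB.
- rewrite (cardsD1 r) rS ltnS card_gt0; apply/set0Pn; exists (~: r).
  by apply/setD1P.
- by exists (~: r).
- by rewrite symdiffxx /weight eqxx andbF.
- move=> v vS vr pr; rewrite parD weight_parent ?neq_r //; last first.
    by rewrite -parD neq_r.
  by move: vS; rewrite inE.
Qed.

Lemma feasible_size_lt : \sum_(v | v != r) C v < 2 ^ d.+1.
Proof.
(* The factor [2 ^ d] is what each pebble off [r] receives, at least, from all strategies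
   together. *)
rewrite -(@ltn_pmul2l (2 ^ d)) ?expn_gt0 //.
apply: leq_ltn_trans (sum_weight_lt d).
apply: (@leq_trans (\sum_A \sum_v weight A (symdiff v r) * C v)); last first.
  by apply: leq_sum => A _; exact: strategy_bound.
rewrite exchange_big big_distrr big_mkcond leq_sum //= => v _.
case: eqVneq => //= /neq_r v0.
by rewrite -big_distrl leq_mul2r sum_weight_ge ?orbT.
Qed.

End CubeOptimum.

Theorem theorem4p2 (R : realType) (d : nat) (hd : 1 <= d) (r : hypercube d) :
  weight_optimum R r < 2 * pebbling_number r.
Proof.
rewrite /weight_optimum; case: ex_maxnP => z /asboolP [C [fC <-]] _.
apply: leq_trans (_ : 2 ^ d.+1 <= _); last first.
  by rewrite expnS leq_mul2l pebbling_number_ge.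
exact: feasible_size_lt fC.
Qed.
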